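(* Let $b\ge1$ be an integer and let $g(t)=\sum_{k=-b}^{b}a_k\exp(j2\pi kt)$, $a_k\in\mathbb{C}$, be real-valued with $|g(t)|\le1$ for all $t\in\mathbb{R}$. Let $U_1,U_2,\ldots$ be i.i.d. random variables uniform on $[0,1]$ and let $U_{1:n}\le U_{2:n}\le\cdots\le U_{n:n}$ be the order statistics of $U_1,\ldots,U_n$. Let $\vec A=[\widehat A_{-b},\ldots,\widehat A_b]^T$ and $\widehat G(t)$ be the estimates (depending on $n$) $$\vec A=\frac{1}{2b+1}\Phi_b^\dagger\vec G,\qquad \widehat G(t)=\sum_{k=-b}^{b}\widehat A_k\exp(j2\pi kt),$$ with $\Phi_b$ and $\vec G$ as defined in the context. Then, as $n\to\infty$, $$n\,\mathbb{E}\left[\|\widehat G-g\|_2^2\right]\le \pi^2b^2(2b+1)\left[1+O\bigl(\sqrt{1/n}\bigr)\right],$$ that is, the expected distortion decreases as $O(1/n)$.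
   Context: Notation: $j=\sqrt{-1}$; $s_b:=1/(2b+1)$; $\phi_k:=\exp(j2\pi k s_b)$; $[x]$ denotes the integer part of $x$. $\Phi_b$ is the $(2b+1)\times(2b+1)$ matrix with rows indexed by $l=0,1,\ldots,2b$, columns indexed by $k=-b,\ldots,b$, and $(l,k)$ entry $(\phi_k)^l$; $\Phi_b^\dagger$ is its conjugate transpose. $\vec G$ is the vector of field samples $$\vec G=\bigl[g(U_{1:n}),\,g(U_{[ns_b]+1:n}),\,\ldots,\,g(U_{[n2bs_b]+1:n})\bigr]^T,$$ i.e. its entry with index $l\in\{0,\ldots,2b\}$ is $g(U_{[nls_b]+1:n})$. The distortion is the average mean-squared error $\mathbb{E}[\|\widehat G-g\|_2^2]=\mathbb{E}\left[\int_0^1|\widehat G(t)-g(t)|^2\,dt\right]$. *)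

(* Defs.v *)
From HB Require Import structures.
From mathcomp Require Import all_boot all_order all_algebra.
From mathcomp Require Import finmap complex.
From mathcomp Require Import all_classical all_reals all_analysis.

Set Implicit Arguments.
Unset Strict Implicit.
Unset Printing Implicit Defensive.

Import Order.TTheory GRing.Theory Num.Theory.
Import numFieldNormedType.Exports.

Local Open Scope classical_set_scope.
Local Open Scope ring_scope.
Local Open Scope complex_scope.
Local Open Scope sesquilinear_scope.

(* Mutual independence of a family of real random variables: the product rule
   over every finite subfamily. *)
Definition mutually_independent d (T : measurableType d) (R : realType)
    (P : probability T R) (I : choiceType) (X : I -> {RV P >-> R}) : Prop :=
  forall (J : {fset I}) (B : I -> set R), (forall i, measurable (B i)) ->
    P (\bigcap_(i in [set` J]) (X i @^-1` B i)) =
    (\prod_(i <- J) P (X i @^-1` B i))%E.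

Definition iid_uniform01 d (T : measurableType d) (R : realType)
    (P : probability T R) (I : choiceType) (X : I -> {RV P >-> R}) : Prop :=
  mutually_independent X /\
  forall i (A : set R), measurable A ->
    distribution P (X i) A = uniform_prob (@ltr01 R) A.

(* u_{k:n}, the k-th smallest (k counted from 1) of the first n terms of u,
   which are u 0, ..., u n.-1. *)
Definition order_stat (R : realType) (u : nat -> R) (n k : nat) : R :=
  nth 0 (sort <=%R [seq u i | i <- iota 0 n]) k.-1.

(* exp(j x) for real x, by Euler's formula. *)
Definition expj (R : realType) (x : R) : R[i] := Complex (cos x) (sin x).

Section Field.
Variables (R : realType) (b : nat).

(* Families indexed by -b, ..., b are indexed here by 'I_(2 * b).+1: position
   k stands for the frequency k - b. *)
Definition freq (k : 'I_(2 * b).+1) : int := k%:Z - b%:Z.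

Definition s_ : R := 1 / (2 * b%:R + 1).

Definition phi (k : int) : R[i] := expj (2 * pi * k%:~R * s_).

Definition Phi : 'M[R[i]]_((2 * b).+1, (2 * b).+1) :=
  \matrix_(l, k) phi (freq k) ^+ l.

Definition trigpoly (a : 'cV[R[i]]_(2 * b).+1) (t : R) : R[i] :=
  \sum_(k < (2 * b).+1) a k 0 * expj (2 * pi * (freq k)%:~R * t).

Definition samples (g : R -> R) (u : nat -> R) (n : nat)
    : 'cV[R[i]]_(2 * b).+1 :=
  \col_(l < (2 * b).+1)
    (g (order_stat u n (Num.truncn (n%:R * l%:R * s_)).+1))%:C.

Definition Ahat (g : R -> R) (u : nat -> R) (n : nat)
    : 'cV[R[i]]_(2 * b).+1 :=
  (1 / (2 * b%:R + 1)) *: (Phi ^t* *m samples g u n).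

Definition Ghat (g : R -> R) (u : nat -> R) (n : nat) : R -> R[i] :=
  trigpoly (Ahat g u n).

Definition sq_error (g : R -> R) (u : nat -> R) (n : nat) : R :=
  \int[lebesgue_measure]_(t in `[0, 1])
    ComplexField.Normc.normc (Ghat g u n t - (g t)%:C) ^+ 2.

Definition distortion d (T : measurableType d) (P : probability T R)
    (U : nat -> {RV P >-> R}) (g : R -> R) (n : nat) : \bar R :=
  ('E_P[fun w => sq_error g (U^~ w) n])%E.

End Field.

(* Main.v *)
Require Import Defs.
From HB Require Import structures.
From mathcomp Require Import all_boot all_order all_algebra.
From mathcomp Require Import finmap complex.
From mathcomp Require Import all_classical all_reals all_analysis.
From mathcomp Require Import measurable_realfun ring lra zify.

Set Implicit Arguments.
Unset Strict Implicit.
Unset Printing Implicit Defensive.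

Import Order.TTheory GRing.Theory Num.Theory.
Import numFieldNormedType.Exports.
Import ComplexField.Normc.

Local Open Scope classical_set_scope.
Local Open Scope ring_scope.
Local Open Scope complex_scope.
Local Open Scope sesquilinear_scope.

(** Write N = 2b + 1.  Since Phi^* Phi = N I, both the discrete and the
continuous Parseval identities apply and the distortion is exactly
  (1/N) sum_l E (g(U_(r_l)) - g(l/N))^2.
By Cauchy-Schwarz and sum_k |a_k|^2 <= 1, g is Lipschitz with
  L^2 = 4 pi^2 sum_k k^2 = 4 pi^2 b (b+1) (2b+1) / 3,
so Bernstein's sharp inequality |g'| <= 2 pi b is not needed.  The second
moment of U_(r) around p is computed from P(U_(r) > x), which is a binomial
tail, by Tonelli and the beta integral:
  E (U_(r) - p)^2 = p^2 + r (r+1) / ((n+1) (n+2)) - 2 p r / (n+1).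
For |r - n p| <= 1 this is at most 1/(4n) + O(1/n^2), hence at most 3/(8n) for
n >= 8.  Altogether n times the distortion is at most
pi^2 b (b+1) (2b+1) / 2 <= pi^2 b^2 (2b+1), so the factor 1 + O(sqrt(1/n)) can
even be taken equal to 1. *)

(** * Exponentials and Fourier orthogonality *)

Section Trigonometric.
Variable R : realType.
Implicit Types (x y w : R) (z : R[i]) (m : int).

Lemma expjD x y : expj (x + y) = expj x * expj y.
Proof.
apply/eqP; rewrite eq_complex /= cosD sinD.
by apply/andP; split; apply/eqP; ring.
Qed.

Lemma expj0 : expj (0 : R) = 1.
Proof. by rewrite /expj cos0 sin0. Qed.

Lemma conj_expj x : Num.conj (expj x) = expj (- x).
Proof. by rewrite /expj cosN sinN. Qed.

Lemma expjMn x n : expj (n%:R * x) = expj x ^+ n.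
Proof.
elim: n => [|n IHn]; first by rewrite mul0r expj0.
by rewrite exprS -IHn -natr1 mulrDl mul1r addrC expjD.
Qed.

Lemma expj2pi m : expj (2 * pi * m%:~R) = 1 :> R[i].
Proof.
have e1 : expj (2 * pi) = 1 :> R[i].
  by rewrite /expj (_ : 2 * pi = pi *+ 2) ?mulr_natl // cos2pi sin2pi.
have en n : expj (2 * pi * n%:R) = 1 :> R[i].
  by rewrite mulrC expjMn e1 expr1n.
case: m => n; first exact: en.
by rewrite NegzE rmorphN mulrN -conj_expj en rmorph1.
Qed.

Lemma normc_sqrE z : normc z ^+ 2 = complex.Re z ^+ 2 + complex.Im z ^+ 2.
Proof. by case: z => u v /=; rewrite sqr_sqrtr // addr_ge0 ?sqr_ge0. Qed.

Lemma normc_sqrC z : (normc z ^+ 2)%:C = Num.conj z * z.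
Proof.
rewrite normc_sqrE; case: z => u v; apply/eqP.
by rewrite eq_complex /=; apply/andP; split; apply/eqP; ring.
Qed.

Lemma norm_sin_le x : `|sin x| <= `|x|.
Proof.
wlog x0 : x / 0 <= x.
  move=> H; have [/H//|/ltW x0] := leP 0 x.
  by rewrite -normrN -sinN -(normrN x); apply: H; rewrite oppr_ge0.
have [c _] : exists2 c : R, c \in `[0, x] & sin x - sin 0 = cos c * (x - 0).
  apply: MVT_segment => //.
  by apply: continuous_subspaceT; exact: continuous_sin.
by rewrite sin0 !subr0 => ->; rewrite normrM ler_piMl // cos_max.
Qed.

(** The chord between two points of the unit circle has length [2 * |sin ((x - y) / 2)|], which is
    at most the arc [|x - y|]. *)
Lemma normc_expjB x y : normc (expj x - expj y) ^+ 2 <= (x - y) ^+ 2.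
Proof.
have -> : normc (expj x - expj y) ^+ 2 = 4 * sin ((x - y) / 2) ^+ 2.
  have -> : 4 * sin ((x - y) / 2) ^+ 2 = 2 - 2 * cos (x - y).
    have -> : x - y = ((x - y) / 2) *+ 2 by rewrite -mulr_natr; field.
    rewrite cos_mulr2n cos2sin2 -mulr_natr.
    rewrite (_ : (_ *+ 2) / 2 = (x - y) / 2); last by rewrite -mulr_natr; field.
    by ring.
  rewrite normc_sqrE /= cosB.
  have := cos2Dsin2 x; have := cos2Dsin2 y; lra.
have : `|sin ((x - y) / 2)| ^+ 2 <= `|(x - y) / 2| ^+ 2.
  by rewrite lerXn2r ?nnegrE // norm_sin_le.
rewrite !real_normK ?num_real // expr_div_n; lra.
Qed.

End Trigonometric.

Section Fourier.
Variables (R : realType) (b : nat).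
Local Notation N := (2 * b).+1.
Local Notation s_ := (s_ R b).
Local Notation Phi := (Phi R b).

Lemma natr_width : N%:R = 2 * b%:R + 1 :> R.
Proof. by rewrite -natr1 natrM. Qed.

Lemma s_E : s_ = N%:R^-1.
Proof. by rewrite /Defs.s_ -natr_width div1r. Qed.

(** With [t = pi * m / N], the equality [cos (2 t) = 1] forces [sin t = 0]; but up to sign [t] lies
    strictly between 0 and [pi]. *)
Lemma expj_s_neq1 (m : int) : m != 0 -> (`|m| < N)%N ->
  expj (2 * pi * m%:~R * s_) != 1.
Proof.
move=> m0 mN; suff: sin (pi * m%:~R * s_) != 0.
  rewrite s_E; apply: contra_neqN => /eqP[+ _].
  have -> : 2 * pi * m%:~R / N%:R = (pi * m%:~R / N%:R) *+ 2 :> R.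
    by rewrite -mulr_natr; ring.
  rewrite cos_mulr2n cos2sin2 => h.
  by apply/eqP; rewrite -(sqrf_eq0 (sin _)); apply/eqP; lra.
have main (n : nat) : (0 < n)%N -> (n < N)%N -> sin (pi * n%:R * s_) != 0.
  move=> n0 nN; rewrite gt_eqF // sin_gt0_pi // s_E.
  rewrite divr_gt0 ?mulr_gt0 ?pi_gt0 ?ltr0n //=.
  by rewrite ltr_pdivrMr ?ltr0n // ltr_pM2l ?pi_gt0 // ltr_nat.
case: m m0 mN => n m0 mN; first by apply: main => //; rewrite lt0n.
by rewrite NegzE rmorphN mulrN mulNr sinN oppr_eq0 main.
Qed.

(** This is a geometric sum whose ratio is an N-th root of unity other than 1. *)
Lemma sum_expj_s (m : int) : m != 0 -> (`|m| < N)%N ->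
  \sum_(l < N) expj (2 * pi * m%:~R * s_) ^+ l = 0.
Proof.
move=> m0 mN; have := expj_s_neq1 m0 mN; set z := expj _ => z1.
have zN : z ^+ N = 1.
  rewrite -expjMn (_ : N%:R * _ = 2 * pi * m%:~R) ?expj2pi // s_E.
  by rewrite mulrCA mulfV ?mulr1 // pnatr_eq0.
have := subrX1 z N; rewrite zN subrr => /esym/eqP.
by rewrite mulf_eq0 subr_eq0 (negPf z1) => /eqP.
Qed.

Lemma freqB (k k' : 'I_N) : freq k' - freq k = k'%:Z - k%:Z.
Proof. by rewrite /freq; ring. Qed.

Lemma freqB_neq0 (k k' : 'I_N) : k != k' -> freq k' - freq k != 0.
Proof. by rewrite freqB subr_eq0 eqz_nat eq_sym. Qed.

Lemma freqB_lt (k k' : 'I_N) : (`|freq k' - freq k| < N)%N.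
Proof. by rewrite freqB; have := ltn_ord k; have := ltn_ord k'; lia. Qed.

(** Entry [(k, k')] is the geometric sum at the frequency difference [k' - k], whose absolute value
    is below N: it vanishes off the diagonal and has N terms equal to 1 on it. *)
Lemma conj_Phi_mul : Phi^t* *m Phi = N%:R%:M.
Proof.
apply/matrixP => k k'; rewrite !mxE.
under eq_bigr => l _.
  rewrite !mxE rmorphXn /= -exprMn /phi conj_expj -expjD.
  rewrite (_ : - _ + _ = 2 * pi * (freq k' - freq k)%:~R * s_); last first.
    by rewrite (rmorphB _ (freq k')); ring.
  over.
have [<-|kk'] := eqVneq k k'; last first.
  by rewrite sum_expj_s ?freqB_neq0 ?freqB_lt // mulr0n.
under eq_bigr do rewrite subrr mulr0 mul0r expj0 expr1n.
by rewrite sumr_const card_ord.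
Qed.

(** A left inverse of a square matrix is also a right inverse. *)
Lemma Phi_mul_conj : Phi *m Phi^t* = N%:R%:M.
Proof.
have N0 : N%:R != 0 :> R[i] by rewrite pnatr_eq0.
have : (N%:R^-1 *: Phi^t*) *m Phi = 1%:M.
  by rewrite -scalemxAl conj_Phi_mul scale_scalar_mx mulVf.
move/mulmx1C; rewrite -scalemxAr => /(congr1 ( *:%R N%:R)).
by rewrite scalerA mulfV // scale1r scale_scalar_mx mulr1.
Qed.

Lemma sum_normc_sqr n (v : 'cV[R[i]]_n) :
  (\sum_i normc (v i 0) ^+ 2)%:C = (v^t* *m v) 0 0.
Proof.
rewrite rmorph_sum mxE; apply: eq_bigr => i _.
by rewrite !mxE; exact: normc_sqrC.
Qed.

(** Discrete Parseval: the left side is [v^* A^* A v]. It is applied both to [Phi] and to its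
    conjugate transpose. *)
Lemma sum_normc_sqr_mul (A : 'M[R[i]]_N) (v : 'cV[R[i]]_N) :
    A^t* *m A = N%:R%:M ->
  \sum_i normc ((A *m v) i 0) ^+ 2 = N%:R * \sum_i normc (v i 0) ^+ 2.
Proof.
move=> AA; apply: (@complexI R); rewrite sum_normc_sqr rmorphM /= sum_normc_sqr.
rewrite trmx_mul map_mxM -mulmxA (mulmxA _ A) AA mul_scalar_mx -scalemxAr mxE.
by rewrite rmorph_nat.
Qed.

Lemma trigpoly_s (a : 'cV[R[i]]_N) (l : 'I_N) :
  trigpoly a (l%:R * s_) = (Phi *m a) l 0.
Proof.
rewrite /trigpoly mxE; apply: eq_bigr => k _; rewrite mxE mulrC; congr (_ * _).
by rewrite /phi -expjMn; congr expj; ring.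
Qed.

End Fourier.

(** * Parseval and the Lipschitz bound *)

Section Parseval.
Variable R : realType.
Local Notation mu := (@lebesgue_measure R).

Lemma continuous_integrable_itv (f : R -> R) (x y : R) :
  continuous f -> mu.-integrable `[x, y] (EFin \o f).
Proof.
move=> cf; apply: continuous_compact_integrable; first exact: segment_compact.
exact: continuous_subspaceT.
Qed.

Lemma integral_is_derive (F f : R -> R) (x y : R) : x <= y ->
    (forall t : R, is_derive t (1 : R) F (f t)) -> continuous f ->
  (\int[mu]_(t in `[x, y]) (f t)%:E = (F y - F x)%:E)%E.
Proof.
rewrite le_eqVlt => /predU1P[<- _ _|xy dF cf].
  by rewrite set_itv1 integral_set1 subrr.
have cF : continuous F.
  move=> t; apply/differentiable_continuous/derivable1_diffP.
  exact: (@ex_derive _ _ _ _ _ _ _ (dF t)).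
rewrite (continuous_FTC2 xy _ (F := F)) ?EFinB //.
- exact: continuous_subspaceT.
- split; [|exact/cvg_at_right_filter/cF|exact/cvg_at_left_filter/cF].
  by move=> t _; exact: (@ex_derive _ _ _ _ _ _ _ (dF t)).
- by move=> t _; rewrite derive1E; exact: (@derive_val _ _ _ _ _ _ _ (dF t)).
Qed.

Lemma continuous_cos_sin (u v w : R) :
  continuous (fun t => u * cos (w * t) - v * sin (w * t)).
Proof.
move=> t; have cl : {for t, continuous (fun t : R => w * t)}.
  by apply: cvgM; [exact: cvg_cst|exact: cvg_id].
apply: cvgB; apply: cvgM; try exact: cvg_cst.
  exact: (continuous_comp cl (@continuous_cos R _)).
exact: (continuous_comp cl (@continuous_sin R _)).
Qed.

(** The integrand is the real part of [(u + j v) * expj (2 * pi * m * t)]. For [m] non-zero it has a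
    primitive of period 1, so the integral over a full period vanishes. *)
Lemma integral_cos_sin (u v : R) (m : int) :
  (\int[mu]_(t in `[0%R, 1%R])
     (u * cos (2 * pi * m%:~R * t) - v * sin (2 * pi * m%:~R * t))%:E =
   (u *+ (m == 0))%:E)%E.
Proof.
set w := 2 * pi * m%:~R.
have cw := @continuous_cos_sin u v w.
have [m0|m0] := eqVneq m 0.
  have dF (t : R) : is_derive t (1 : R) (fun t => u * t)
      (u * cos (w * t) - v * sin (w * t)).
    rewrite /w m0 mulr0 mul0r cos0 sin0 mulr0 subr0.
    by apply: is_derive_eq; rewrite /GRing.scale /= mulr1.
  by rewrite (integral_is_derive ler01 dF cw) mulr1 mulr0 subr0 mulr1n.
have w0 : w != 0.
  by rewrite mulf_neq0 ?intr_eq0 // mulf_neq0 ?pnatr_eq0 // gt_eqF ?pi_gt0.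
have dF (t : R) : is_derive t (1 : R)
    (fun t => w^-1 * (u * sin (w * t) + v * cos (w * t)))
    (u * cos (w * t) - v * sin (w * t)).
  apply: is_derive_eq; rewrite /GRing.scale /=.
  by field.
rewrite (integral_is_derive ler01 dF cw).
have /eqP : expj w = 1 :> R[i] by exact: expj2pi.
rewrite eq_complex /= => /andP[/eqP c1 /eqP s0].
by rewrite mulr1 c1 s0 !mulr0 cos0 sin0 mulr0 mulr1 subrr.
Qed.

Lemma Re_conj_mul_expj (z1 z2 : R[i]) (x y : R) :
  complex.Re (Num.conj (z1 * expj x) * (z2 * expj y)) =
  complex.Re (Num.conj z1 * z2) * cos (y - x) -
  complex.Im (Num.conj z1 * z2) * sin (y - x).
Proof. by case: z1 z2 => [u1 v1] [u2 v2] /=; rewrite cosB sinB; ring. Qed.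

(** The expanded double sum is its own conjugate once its two indices are exchanged. It is therefore
    real and may be replaced by the sum of the real parts, which keeps the later integration
    real-valued. *)
Lemma normc_sum_sqr (I : finType) (z : I -> R[i]) :
  normc (\sum_i z i) ^+ 2 =
  \sum_i \sum_j complex.Re (Num.conj (z i) * z j).
Proof.
apply: (@complexI R); rewrite normc_sqrC rmorph_sum mulr_suml.
have -> : \sum_i Num.conj (z i) * \sum_j z j =
    \sum_i \sum_j Num.conj (z i) * z j.
  by apply: eq_bigr => i _; rewrite mulr_sumr.
set S := \sum_i _; suff ImS : complex.Im S = 0.
  rewrite [LHS]complexE ImS mulr0 addr0 raddf_sum; congr (_%:C).
  by apply: eq_bigr => i _; rewrite raddf_sum.
have : Num.conj S = S.
  rewrite rmorph_sum; under eq_bigr do rewrite rmorph_sum.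
  rewrite exchange_big; apply: eq_bigr => i _; apply: eq_bigr => j _.
  by rewrite rmorphM mulrC; congr (_ * _); exact: conjCK.
by case: S => u v /= [] vN; lra.
Qed.

(** The squared modulus expands into a double sum of real oscillations at the frequencies [k' - k];
    only the diagonal terms have non-zero integral. *)
Lemma parseval (b : nat) (e : 'cV[R[i]]_(2 * b).+1) :
  (\int[mu]_(t in `[0%R, 1%R]) (normc (trigpoly e t) ^+ 2)%:E =
   (\sum_k normc (e k 0) ^+ 2)%:E)%E.
Proof.
pose c k k' := Num.conj (e k 0) * e k' 0.
pose m (k k' : 'I_(2 * b).+1) := freq k' - freq k.
pose f k k' (t : R) := complex.Re (c k k') * cos (2 * pi * (m k k')%:~R * t)
  - complex.Im (c k k') * sin (2 * pi * (m k k')%:~R * t).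
have fE t : normc (trigpoly e t) ^+ 2 = \sum_k \sum_k' f k k' t.
  rewrite normc_sum_sqr; apply: eq_bigr => k _; apply: eq_bigr => k' _.
  rewrite Re_conj_mul_expj /f -mulrBl -mulrBr /m.
  by rewrite (rmorphB _ (freq k')).
have intf k k' : mu.-integrable `[0, 1] (EFin \o f k k').
  exact/continuous_integrable_itv/continuous_cos_sin.
under eq_integral do rewrite fE -sumEFin.
rewrite integral_sum //=; last first.
  move=> k; rewrite [X in mu.-integrable _ X](_ : _ =
    fun t => (\sum_k' (EFin \o f k k') t)%E); last first.
    by apply/funext => t /=; rewrite -sumEFin.
  by apply: integrable_sum.
rewrite -sumEFin; apply: eq_bigr => k _.
under eq_integral do rewrite -sumEFin.
rewrite integral_sum //=; last by move=> k'; exact: intf.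
under eq_bigr => k' _ do rewrite integral_cos_sin.
rewrite sumEFin (bigD1 k) //= big1 => [|k' kk'].
  rewrite /m subrr eqxx mulr1n addr0; congr (_%:E).
  by rewrite /c -normc_sqrC.
by rewrite (negbTE (freqB_neq0 _)) // eq_sym.
Qed.

End Parseval.

Section Lipschitz.
Variable R : realType.

(** After the right side is symmetrized in [i] and [j], both sides are double sums, and the terms
    compare by [2 u v <= u^2 + v^2]. *)
Lemma cauchy_schwarz_sum (I : finType) (x y : I -> R) :
  (\sum_i x i * y i) ^+ 2 <= (\sum_i x i ^+ 2) * (\sum_i y i ^+ 2).
Proof.
have E : (\sum_i x i ^+ 2) * (\sum_i y i ^+ 2) =
    \sum_i \sum_j ((x i * y j) ^+ 2 + (x j * y i) ^+ 2) / 2.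
  have S : \sum_i \sum_j (x i * y j) ^+ 2 =
      (\sum_i x i ^+ 2) * (\sum_i y i ^+ 2).
    rewrite mulr_suml; apply: eq_bigr => i _; rewrite mulr_sumr.
    by apply: eq_bigr => j _; rewrite exprMn.
  under [RHS]eq_bigr do rewrite -mulr_suml big_split.
  by rewrite -mulr_suml big_split /= [X in _ + X]exchange_big /= S; field.
rewrite {}E expr2 mulr_suml; apply: ler_sum => i _.
rewrite mulr_sumr; apply: ler_sum => j _.
have := sqr_ge0 (x i * y j - x j * y i); nra.
Qed.

Lemma normc_sum (I : finType) (z : I -> R[i]) :
  normc (\sum_i z i) <= \sum_i normc (z i).
Proof.
elim/big_ind2 : _ => [|x1 x2 y1 y2 h1 h2|//]; first by rewrite normc0.
by rewrite (le_trans (le_normcD _ _)) // lerD.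
Qed.

Lemma sum_shifted_sqr n (c : R) :
  \sum_(k < n) (k%:R - c) ^+ 2 =
  (n%:R - 1) * n%:R * (2 * n%:R - 1) / 6
  - c * n%:R * (n%:R - 1) + n%:R * c ^+ 2.
Proof.
elim: n => [|n IHn]; first by rewrite big_ord0; ring.
by rewrite big_ord_recr /= IHn -natr1; field.
Qed.

Lemma sum_freq_sqr (b : nat) :
  \sum_(k < (2 * b).+1) (freq k)%:~R ^+ 2 =
  b%:R * (b%:R + 1) * (2 * b%:R + 1) / 3 :> R.
Proof.
under eq_bigr do rewrite rmorphB /=.
by rewrite sum_shifted_sqr natr_width; field.
Qed.

Variables (b : nat) (a : 'cV[R[i]]_(2 * b).+1) (g : R -> R).
Hypothesis ga : forall t : R, (g t)%:C = trigpoly a t.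
Hypothesis g1 : forall t : R, `|g t| <= 1.

(** By discrete Parseval, N times this sum equals the sum of [g(l/N)^2] over the N grid points, and
    each of those terms is at most 1. *)
Lemma sum_coef_le1 : \sum_k normc (a k 0) ^+ 2 <= 1.
Proof.
have N0 : 0 < (2 * b).+1%:R :> R by rewrite ltr0n.
rewrite -(ler_pM2l N0) mulr1 -(sum_normc_sqr_mul _ (conj_Phi_mul R b)).
rewrite -[leRHS]mulr_natl mulr_natl -[X in _ *+ X]card_ord -sumr_const.
apply: ler_sum => l _; rewrite -trigpoly_s -ga normc_sqrE /= expr0n addr0.
by rewrite -real_normK ?num_real // expr_le1.
Qed.

(** The increment of [g] pairs the coefficients with the increments of the exponentials.
    Cauchy-Schwarz separates the two, the coefficients contribute at most 1, and each exponential
    contributes [(2 * pi * k)^2 * (x - y)^2]. *)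
Lemma trigpoly_lipschitz (x y : R) : (g x - g y) ^+ 2 <=
  4 * pi ^+ 2 * (b%:R * (b%:R + 1) * (2 * b%:R + 1) / 3) * (x - y) ^+ 2.
Proof.
pose d (k : 'I_(2 * b).+1) : R[i] :=
  expj (2 * pi * (freq k)%:~R * x) - expj (2 * pi * (freq k)%:~R * y).
have gE : (g x - g y)%:C = \sum_k a k 0 * d k.
  rewrite rmorphB /= !ga /trigpoly -sumrB; apply: eq_bigr => k _.
  by rewrite -mulrBr.
have -> : (g x - g y) ^+ 2 = normc (\sum_k a k 0 * d k) ^+ 2.
  by rewrite -gE normc_sqrE /= expr0n addr0.
have S0 : 0 <= \sum_k normc (a k 0 * d k).
  by apply: sumr_ge0 => k _; case: (_ * _) => u v; exact: sqrtr_ge0.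
apply: (@le_trans _ _ ((\sum_k normc (a k 0) * normc (d k)) ^+ 2)).
  rewrite -(eq_bigr _ (fun k _ => normcM _ _)) lerXn2r ?nnegrE //.
    by case: (\sum_k _) => u v; exact: sqrtr_ge0.
  exact: normc_sum.
apply: (le_trans (cauchy_schwarz_sum _ _)).
apply: (@le_trans _ _ (\sum_k normc (d k) ^+ 2)).
  rewrite ler_piMl ?sum_coef_le1 //.
  by apply: sumr_ge0 => k _; exact: sqr_ge0.
rewrite -sum_freq_sqr mulr_sumr mulr_suml; apply: ler_sum => k _.
apply: (le_trans (normc_expjB _ _)).
by rewrite le_eqVlt; apply/orP; left; apply/eqP; ring.
Qed.

(** The coefficient error is [Phi^*] applied to [v], divided by N, where [v] compares the samples
    with the exact grid values [g(l/N)], which are the entries of [Phi *m a]. Continuous Parseval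
    passes from the integral to the coefficient error, and discrete Parseval from there to [v]. *)
Lemma sq_errorE (u : nat -> R) n : sq_error b g u n =
  (2 * b).+1%:R^-1 * \sum_(l < (2 * b).+1)
    (g (order_stat u n (Num.truncn (n%:R * l%:R * s_ R b)).+1)
     - g (l%:R * s_ R b)) ^+ 2.
Proof.
have N0 : (2 * b).+1%:R != 0 :> R by rewrite pnatr_eq0.
have NC0 : (2 * b).+1%:R != 0 :> R[i] by rewrite pnatr_eq0.
pose v := samples b g u n - Phi R b *m a.
have AE : Ahat b g u n - a = (2 * b).+1%:R^-1 *: ((Phi R b)^t* *m v).
  rewrite mulmxBr mulmxA conj_Phi_mul mul_scalar_mx scalerBr scalerA mulVf //.
  have -> : (2 * b).+1%:R = 2 * b%:R + 1 :> R[i] by rewrite -natr1 natrM.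
  by rewrite scale1r /Ahat div1r.
have -> : sq_error b g u n = \sum_k normc ((Ahat b g u n - a) k 0) ^+ 2.
  rewrite /sq_error /Rintegral -[RHS]/(fine (\sum_k _)%:E) -parseval.
  congr fine; apply: eq_integral => t _; congr (_ ^+ 2)%:E; congr normc.
  rewrite ga /Ghat /trigpoly -sumrB; apply: eq_bigr => k _.
  by rewrite !mxE mulrBl.
(* Discrete Parseval is now needed for [Phi^*] in place of [Phi], hence the product in the other
   order. *)
have PP : (Phi R b)^t* ^t* *m (Phi R b)^t* = (2 * b).+1%:R%:M.
  rewrite -[RHS]Phi_mul_conj; congr (_ *m _).
  by apply/matrixP => i j; rewrite !mxE conjCK.
have E : \sum_k normc ((Ahat b g u n - a) k 0) ^+ 2 =
    (2 * b).+1%:R^-1 ^+ 2 * \sum_k normc (((Phi R b)^t* *m v) k 0) ^+ 2.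
  rewrite AE mulr_sumr; apply: eq_bigr => k _.
  rewrite mxE normcM exprMn; congr (_ * _).
  rewrite -(rmorph_nat (@real_complex R)) -fmorphV.
  by rewrite normc_sqrE /= expr0n addr0.
rewrite E (sum_normc_sqr_mul _ PP) mulrA expr2 mulfVK //; congr (_ * _).
apply: eq_bigr => l _; rewrite !mxE.
have -> : \sum_j Phi R b l j * a j 0 = (g (l%:R * s_ R b))%:C.
  by rewrite ga trigpoly_s mxE.
by rewrite -rmorphB normc_sqrE /= expr0n addr0.
Qed.

End Lipschitz.

(** * Order statistics *)

Section OrderStatistics.
Variable R : realType.

Definition level_set (u : nat -> R) n (x : R) : {set 'I_n} :=
  [set i : 'I_n | u i <= x].

(** Counting in the sorted list agrees with counting in the original one, so an event about sorting
    becomes one about the number of terms below a level. The bound [k < n] keeps [nth] away from its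
    default value. *)
Lemma order_stat_gt (u : nat -> R) n k (x : R) : (k < n)%N ->
  (x < order_stat u n k.+1) = (#|level_set u n x| <= k)%N.
Proof.
move=> kn; rewrite /order_stat /=; set s := sort _ _.
have ss : sorted <=%R s by apply: sort_sorted; exact: le_total.
have sz : size s = n by rewrite size_sort size_map size_iota.
have -> : #|level_set u n x| = count (<= x) s.
  rewrite count_sort count_map -sum1_card -sum1_count -[n in iota 0 n]subn0.
  by rewrite big_mkord; apply: eq_bigl => i; rewrite inE.
have [h|h] := leqP; first by apply: nth_count_gt => //; rewrite h sz.
by apply/negbTE; rewrite -leNgt nth_count_le.
Qed.

(** The distribution function of the uniform law on [0, 1]. *)
Definition clip01 (x : R) := Num.min 1 (Num.max 0 x).

Context d (T : measurableType d) (P : probability T R).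
Variable U : nat -> {RV P >-> R}.
Hypothesis hU : iid_uniform01 U.

Lemma uniform_cdf i (x : R) :
  P (U i @^-1` `]-oo, x]) = (clip01 x)%:E.
Proof.
rewrite /clip01.
have := hU.2 i `]-oo, x]%classic (measurable_itv _); rewrite /distribution.
rewrite /pushforward => ->; rewrite /uniform_prob integral_uniform_pdf.
have -> : `]-oo, x]%classic `&` `[0, 1] = `[0, Num.min 1 x]%classic :> set R.
  apply/seteqP; split => y /=; rewrite !in_itv /= le_min.
    by move=> [-> /andP[-> ->]].
  by move=> /and3P[-> -> ->].
rewrite (eq_integral (fun=> 1%E)); last first.
  move=> y; rewrite inE /= in_itv /= le_min => /and3P[y0 y1 _].
  by rewrite /uniform_pdf y0 y1 subr0 invr1.
rewrite integral_cst //= mul1e lebesgue_measure_itv /= lte_fin lt_min ltr01 /=.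
have [x0|x0] := ltP 0 x; last by rewrite (min_idPr ler01).
by rewrite sube0.
Qed.

Lemma uniform_ccdf i (x : R) :
  P (U i @^-1` `]x, +oo[) = (1 - clip01 x)%:E.
Proof.
rewrite -setCitvl -preimage_setC probability_setC ?uniform_cdf //.
exact: measurable_funPTI.
Qed.

(* The event that {i < n | U_i <= x} is exactly J is the intersection over
   i < n of the events U_i \in sub_box x J i. *)
Definition sub_box n (x : R) (J : {set 'I_n}) (i : nat) : set R :=
  if i \in map val (enum J) then `]-oo, x]%classic else `]x, +oo[%classic.

(** Independence is stated over finite sets of indices; this finite set stands for the first [n] of
    them. *)
Lemma mem_seq_fset_iota n i : [set` seq_fset tt (iota 0 n)] i <-> (i < n)%N.
Proof.
suff -> : (i < n)%N = (i \in seq_fset tt (iota 0 n)) by [].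
by rewrite seq_fsetE mem_iota.
Qed.

Lemma level_setP n (x : R) (J : {set 'I_n}) w :
  (\bigcap_(i in [set` (seq_fset tt (iota 0 n))])
     (U i @^-1` sub_box x J i)) w <-> level_set (U^~ w) n x = J.
Proof.
have E (i : 'I_n) : (U i @^-1` sub_box x J i) w <-> (U i w <= x) = (i \in J).
  rewrite /sub_box /= (mem_map val_inj) mem_enum.
  case: (i \in J) => /=; rewrite in_itv /= ?andbT; first by split.
  by rewrite ltNge; split => [/negbTE|->].
split=> [H|LJ].
  apply/setP => i; rewrite inE; apply/E/H.
  by apply/mem_seq_fset_iota; exact: ltn_ord.
move=> i /mem_seq_fset_iota ilt.
by apply/(E (Ordinal ilt)); rewrite -LJ inE.
Qed.

(** By independence the probability is a product over [i < n], with factor [clip01 x] for [i] in [J]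
    and [1 - clip01 x] otherwise. *)
Lemma prob_level_set n (x : R) (J : {set 'I_n}) :
  P [set w | level_set (U^~ w) n x = J] =
  (clip01 x ^+ #|J| * (1 - clip01 x) ^+ (n - #|J|))%:E.
Proof.
have -> : [set w | level_set (U^~ w) n x = J] =
    \bigcap_(i in [set` (seq_fset tt (iota 0 n))]) (U i @^-1` sub_box x J i).
  by apply/seteqP; split => w /level_setP.
rewrite hU.1 => [|i]; last by rewrite /sub_box; case: ifP.
have uniq_n := iota_uniq 0 n.
have := seq_fset_perm tt (iota 0 n); rewrite undup_id // => pn.
rewrite (perm_big _ pn) /= -[n in iota 0 n]subn0 big_mkord.
rewrite (eq_bigr (fun i : 'I_n =>
  (if i \in J then clip01 x else 1 - clip01 x)%:E)); last first.
  move=> i _; rewrite /sub_box (mem_map val_inj) mem_enum.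
  by case: ifP => _; [exact: uniform_cdf|exact: uniform_ccdf].
rewrite prodEFin; congr (_%:E).
rewrite (bigID (fun i => i \in J)) /=; congr (_ * _).
  by rewrite (eq_bigr (fun=> clip01 x)) ?prodr_const // => i ->.
rewrite (eq_bigr (fun=> 1 - clip01 x)) => [|i /negbTE ->//].
rewrite prodr_const; congr (_ ^+ _).
rewrite -[X in (X - _)%N](card_ord n) -(cardC J) addKn.
by apply: eq_card => i; rewrite !inE.
Qed.

Lemma measurable_level_set n (x : R) (J : {set 'I_n}) :
  measurable [set w | level_set (U^~ w) n x = J].
Proof.
have -> : [set w | level_set (U^~ w) n x = J] =
    \bigcap_(i in [set` (seq_fset tt (iota 0 n))]) (U i @^-1` sub_box x J i).
  by apply/seteqP; split => w /level_setP.
apply: bigcap_measurableType => i _.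
by apply: measurable_funPTI; rewrite /sub_box; case: ifP.
Qed.

(** The probability that a binomial variable with parameters [n] and [x] is at most [k]. *)
Definition binomial_tail n k (x : R) : R :=
  \sum_(j < k.+1) x ^+ j * (1 - x) ^+ (n - j) *+ 'C(n, j).

(** A finite union of pairwise disjoint events, from which both measurability and probability
    follow. *)
Lemma order_stat_gtE n k (x : R) : (k < n)%N ->
  [set w | x < order_stat (U^~ w) n k.+1] =
  \bigcup_(J in [set` [pred J : {set 'I_n} | #|J| <= k]%N])
    [set w | level_set (U^~ w) n x = J].
Proof.
move=> kn; apply/seteqP; split => w /=; rewrite order_stat_gt //.
  by move=> h; exists (level_set (U^~ w) n x).
by move=> [J /= h ->].
Qed.

Lemma measurable_order_stat n k : (k < n)%N ->
  measurable_fun setT (fun w => order_stat (U^~ w) n k.+1).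
Proof.
move=> kn mD; apply: (measurability _ (RGenOInfty.measurableE R)) => //.
move=> /= _ [_ [x ->] <-]; rewrite setTI.
rewrite [X in measurable X](_ : _ = [set w | x < order_stat (U^~ w) n k.+1]).
  rewrite order_stat_gtE //; apply: fin_bigcup_measurable => // J _.
  exact: measurable_level_set.
by apply/seteqP; split => w /=; rewrite in_itv /= andbT.
Qed.

Lemma prob_order_stat_gt n k (x : R) : (k < n)%N ->
  P [set w | x < order_stat (U^~ w) n k.+1] = (binomial_tail n k (clip01 x))%:E.
Proof.
move=> kn; rewrite order_stat_gtE // measure_fin_bigcup //; first last.
- by move=> J _; exact: measurable_level_set.
- by move=> J1 J2 _ _ [w [/= <- <-]].
rewrite -(bigfs _ (r := index_enum _)) ?index_enum_uniq //=; last first.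
  by move=> J _; rewrite mem_index_enum.
under eq_bigr do rewrite prob_level_set.
rewrite sumEFin; congr (_%:E).
(* The sets [J] are grouped by cardinality. Only those with at most [k] elements occur, so [inord]
   loses nothing, and size [j] accounts for ['C(n, j)] of them. *)
rewrite (partition_big (fun J : {set 'I_n} => inord #|J| : 'I_k.+1) predT) //=.
apply: eq_bigr => j _.
rewrite (eq_bigl (fun J : {set 'I_n} => #|J| == j)); last first.
  move=> J; apply/andP/eqP => [[Jk /eqP <-]|Jj]; first by rewrite inordK.
  rewrite Jj -ltnS ltn_ord; split => //.
  by apply/eqP/val_inj; rewrite /= inordK.
rewrite (eq_bigr (fun=> clip01 x ^+ j * (1 - clip01 x) ^+ (n - j))).
  rewrite sumr_const; congr (_ *+ _).
  rewrite -[in RHS](card_ord n) -card_draws; apply: eq_card => J.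
  by rewrite finset.in_set.
by move=> J /eqP ->.
Qed.

End OrderStatistics.

(** * Second moments from tail probabilities *)

Section SecondMoment.
Variable R : realType.
Local Notation mu := (@lebesgue_measure R).
Local Open Scope ereal_scope.

(* (y - p)^2 is the integral over x of 2 |x - p| on the segment between p and
   y, whichever of the two is larger; no bound on y is needed. *)
Definition deviation_kernel (p y x : R) : R :=
  if (p <= x)%R then if (x < y)%R then (2 * (x - p))%R else 0%R
  else if (y <= x)%R then (2 * (p - x))%R else 0%R.

Lemma deviation_kernel_ge0 p y x : (0 <= deviation_kernel p y x)%R.
Proof.
rewrite /deviation_kernel; have [px|/ltW xp] := leP p x; case: ifP => // _.
  by rewrite mulr_ge0 // subr_ge0.
by rewrite mulr_ge0 // subr_ge0.
Qed.

Lemma measurable_deviation_kernel d (T : measurableType d) (p : R)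
    (Y X : T -> R) : measurable_fun setT Y -> measurable_fun setT X ->
  measurable_fun setT (fun w => deviation_kernel p (Y w) (X w)).
Proof.
move=> mY mX; apply: measurable_fun_ifT; first exact: measurable_fun_ler.
  apply: measurable_fun_ifT => //; first exact: measurable_fun_ltr.
  by apply: measurable_funM => //; exact: measurable_funB.
apply: measurable_fun_ifT => //; first exact: measurable_fun_ler.
by apply: measurable_funM => //; exact: measurable_funB.
Qed.

Lemma integral_deviation_kernel p y :
  \int[mu]_x (deviation_kernel p y x)%:E = ((y - p) ^+ 2)%:E.
Proof.
(* The sign [s] covers both orders of [p] and [y]: it is 1 on [[p, y[] and -1 on [[y, p[]. The
   half-open intervals match the strict and large comparisons in the kernel. *)
have main (s a b : R) : (a <= b)%R ->
    \int[mu]_(x in `[a, b[) (2 * (s * (x - p)))%:E =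
    (s * ((b - p) ^+ 2 - (a - p) ^+ 2))%:E.
  move=> ab; have dF (t : R) : is_derive t (1%R : R)
      (fun t => s * (t - p) ^+ 2)%R (2 * (s * (t - p)))%R.
    by apply: is_derive_eq; rewrite /GRing.scale /=; ring.
  have cf : continuous (fun t : R => 2 * (s * (t - p)))%R.
    move=> t; apply: cvgM; first exact: cvg_cst.
    apply: cvgM; first exact: cvg_cst.
    by apply: cvgB; [exact: cvg_id|exact: cvg_cst].
  rewrite integral_itv_bndo_bndc; last first.
    apply: measurable_funTS; apply/measurable_EFinP.
    exact: continuous_measurable_fun.
  by rewrite (integral_is_derive ab dF cf) mulrBr.
have [py|/ltW yp] := leP p y.
  transitivity (\int[mu]_(x in `[p, y[) (2 * (1 * (x - p)))%:E); last first.
    by rewrite main // subrr expr0n subr0 mul1r.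
  rewrite [RHS]integral_mkcond; apply: eq_integral => x _.
  rewrite patchE /deviation_kernel mul1r; case: ifPn => px; last first.
    rewrite memNset /= ?in_itv /= ?(negbTE px) //.
    by rewrite leNgt (lt_le_trans _ py) // ltNge.
  have [xy|xy] := ltP x y; first by rewrite mem_set //= in_itv /= px xy.
  by rewrite memNset //= in_itv /= ltNge xy andbF.
transitivity (\int[mu]_(x in `[y, p[) (2 * (- 1 * (x - p)))%:E); last first.
  by rewrite main // subrr expr0n /=; congr (_%:E); ring.
rewrite [RHS]integral_mkcond; apply: eq_integral => x _.
rewrite patchE /deviation_kernel; case: (leP p x) => px.
  rewrite memNset /= ?in_itv /= ?[(x < p)%R]ltNge ?px ?andbF //.
  by rewrite ltNge (le_trans yp px).
rewrite mulN1r opprB.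
case: ifPn => yx; first by rewrite mem_set //= in_itv /= yx px.
by rewrite memNset //= in_itv /= (negbTE yx).
Qed.

Lemma integral_if_cst d (T : measurableType d) (P : probability T R)
    (f : T -> bool) (c : R) : measurable [set w | f w] ->
  \int[P]_w (if f w then c else 0%R)%:E = c%:E * P [set w | f w].
Proof.
move=> mf; rewrite -integral_cst // [RHS]integral_mkcond.
apply: eq_integral => w _; rewrite patchE.
by case: ifPn => fw; [rewrite mem_set|rewrite memNset //=; exact/negP].
Qed.

(** By Tonelli, expectation is taken inside the integral over [x]. For [x >= p] this gives
    [2 (x - p) P(X > x)]. For [x < p] it gives [2 (p - x) (1 - P(X > x))], that is the same
    expression plus [2 (p - x)], and this extra term integrates to [p^2] over [0, p]. The values of
    [Q] at 0 and 1 make everything vanish outside [0, 1]. *)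
Lemma second_moment_ccdf d (T : measurableType d) (P : probability T R)
    (X : T -> R) (Q : R -> R) (p : R) :
    measurable_fun setT X -> (0 <= p <= 1)%R -> continuous Q ->
    Q 0%R = 1%R -> Q 1%R = 0%R ->
    (forall x, P [set w | (x < X w)%R] = (Q (clip01 x))%:E) ->
  \int[P]_w ((X w - p) ^+ 2)%:E =
  (p ^+ 2)%:E + \int[mu]_(x in `[0%R, 1%R]) (2 * (x - p) * Q x)%:E.
Proof.
move=> mX /andP[p0 p1] cQ Q0 Q1 PX.
have mgt x : measurable [set w | (x < X w)%R].
  rewrite -[X in measurable X]setTI.
  have := @measurable_fun_ltr _ _ _ setT (cst x) X (measurable_cst _) mX.
  by move=> /(_ measurableT [set true]); exact.
under eq_integral do rewrite -integral_deviation_kernel.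
rewrite (fubini_tonelli
  (fun z : T * measurableTypeR R =>
    (deviation_kernel p (X z.1) z.2)%:E)); first last.
- by move=> z; rewrite lee_fin deviation_kernel_ge0.
- apply/measurable_EFinP; apply: measurable_deviation_kernel => //.
  exact: measurableT_comp.
have c2 : continuous (fun x : R => 2 * (x - p) * Q x)%R.
  move=> t; apply: cvgM; last exact: cQ.
  by apply: cvgM; [exact: cvg_cst|apply: cvgB; [exact: cvg_id|exact: cvg_cst]].
(* Writing [p^2] as the integral of the kernel at [y = 0] turns both sides into integrals over the
   whole line, which are then compared pointwise. *)
have pE : (p ^+ 2)%:E = \int[mu]_x (deviation_kernel p 0 x)%:E.
  by rewrite integral_deviation_kernel sub0r sqrrN.
rewrite pE [X in _ + X]integral_mkcond -integralD //=.
- apply: eq_integral => x _; rewrite patchE /fubini_G /=.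
  have [px|xp] := leP p x.
    transitivity (\int[P]_w (if (x < X w)%R then 2 * (x - p) else 0)%R%:E).
      by apply: eq_integral => w _; rewrite /deviation_kernel px.
    rewrite integral_if_cst // PX /deviation_kernel px.
    rewrite ltNge (le_trans p0 px) /= add0e /clip01 (max_idPr (le_trans p0 px)).
    case: ifPn => [|x1].
      by rewrite inE /= in_itv /= => /andP[_ x1]; rewrite (min_idPr x1) EFinM.
    rewrite (_ : Num.min 1 x = 1)%R ?Q1 ?mule0 //; apply/min_idPl.
    move: x1; rewrite notin_setE /= in_itv /= (le_trans p0 px) /= => /negP.
    by rewrite -ltNge => /ltW.
  transitivity (\int[P]_w (if (X w <= x)%R then 2 * (p - x) else 0)%R%:E).
    by apply: eq_integral => w _; rewrite /deviation_kernel leNgt xp.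
  have setE : [set w | (X w <= x)%R] = ~` [set w | (x < X w)%R] :> set T.
    by apply/seteqP; split => w /=; rewrite leNgt => /negP.
  rewrite integral_if_cst setE; last exact: measurableC.
  rewrite probability_setC // PX /deviation_kernel leNgt xp /=.
  have [x0|x0] := leP 0%R x.
    rewrite mem_set /= ?in_itv /= ?x0 ?(ltW (lt_le_trans xp p1)) //.
    rewrite /clip01 (max_idPr x0) (min_idPr (ltW (lt_le_trans xp p1))).
    by rewrite -EFinB -EFinM -EFinD; congr (_%:E); ring.
  rewrite memNset /= ?in_itv /= ?leNgt ?x0 //.
  rewrite /clip01 (max_idPl (ltW x0)) (min_idPr ler01) Q0.
  by rewrite subee // mule0 adde0.
- apply/integrableP; split.
    by apply/measurable_EFinP; apply: measurable_deviation_kernel.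
  under eq_integral do rewrite gee0_abs ?lee_fin ?deviation_kernel_ge0 //.
  by rewrite -pE ltry.
- by rewrite -integrable_mkcond //; exact: continuous_integrable_itv.
Qed.

End SecondMoment.

(** * Binomial tails and beta integrals *)

Section BinomialTail.
Variable R : realType.
Local Notation mu := (@lebesgue_measure R).

Lemma continuous_binomial_tail n k : continuous (@binomial_tail R n k).
Proof.
elim: k => [|k IHk].
  rewrite (_ : binomial_tail n 0 = XMonemX 0 n).
    exact: continuous_XMonemX.
  by apply/funext => y; rewrite /binomial_tail big_ord1 /= subn0 bin0 mulr1n.
rewrite (_ : binomial_tail n k.+1 = fun y =>
  binomial_tail n k y + 'C(n, k.+1)%:R * XMonemX k.+1 (n - k.+1) y).
  move=> y; apply: cvgD; first exact: IHk.
  by apply: cvgM; [exact: cvg_cst|exact: continuous_XMonemX].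
by apply/funext => y; rewrite /binomial_tail big_ord_recr /= mulr_natl.
Qed.

Lemma binomial_tail0 n k : binomial_tail n k 0 = 1 :> R.
Proof.
rewrite /binomial_tail big_ord_recl big1 => [|j _].
  by rewrite expr0 mul1r subr0 expr1n bin0 mulr1n addr0.
by rewrite expr0n /= mul0r mul0rn.
Qed.

Lemma binomial_tail1 n k : (k < n)%N -> binomial_tail n k 1 = 0 :> R.
Proof.
move=> kn; rewrite /binomial_tail big1 // => j _.
have jn : (j < n)%N by rewrite (leq_ltn_trans _ kn) // -ltnS.
by rewrite subrr expr0n subn_eq0 leqNgt jn mulr0 mul0rn.
Qed.

(** Euler's beta integral at the integer arguments [a + 1] and [b + 1]. *)
Lemma integral_XMonemX a b : (\int[mu]_(x in `[0%R, 1%R]) (XMonemX a b x)%:E =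
  ((a`! * b`!)%:R / (a + b).+1`!%:R)%:E)%E.
Proof.
rewrite -beta_fun_fact EFin_beta_fun integral_XMonemX_restrict /=.
by rewrite setTI.
Qed.

(** The beta integrals of the two parts of term [j], multiplied by ['C(n, j)], are
    [(j + 1) / ((n + 1) (n + 2))] and [1 / (n + 1)]. Summing over [j <= k] uses
    [1 + ... + (k + 1) = (k + 1) (k + 2) / 2]. *)
Lemma integral_binomial_tail n k (p : R) : (k < n)%N ->
  (\int[mu]_(x in `[0%R, 1%R]) (2 * (x - p) * binomial_tail n k x)%:E =
   (k.+1%:R * k.+2%:R / (n.+1%:R * n.+2%:R) - 2 * p * k.+1%:R / n.+1%:R)%:E)%E.
Proof.
move=> kn.
pose f (j : 'I_k.+1) (x : R) :=
  (2 * 'C(n, j)%:R) * XMonemX j.+1 (n - j) x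
  - (2 * p * 'C(n, j)%:R) * XMonemX j (n - j) x.
have iM c a b : mu.-integrable `[0, 1] (EFin \o (fun x => c * XMonemX a b x)).
  apply: continuous_integrable_itv => x.
  by apply: cvgM; [exact: cvg_cst|exact: continuous_XMonemX].
have IM c a b : (\int[mu]_(x in `[0%R, 1%R]) (c * XMonemX a b x)%:E =
  (c * ((a`! * b`!)%:R / (a + b).+1`!%:R))%:E)%E.
  under eq_integral do rewrite EFinM.
  by rewrite integralZl ?integral_XMonemX //; exact: integrable_XMonemX.
under eq_integral => x _.
  rewrite (_ : _ * _ = \sum_j f j x); last first.
    rewrite /binomial_tail mulr_sumr; apply: eq_bigr => j _.
    by rewrite /f /XMonemX /unstable.onem exprS -mulr_natr; ring.
  rewrite -sumEFin.
  over.
rewrite integral_sum //=; last first.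
  by move=> j; exact: (integrableB _ (iM _ _ _) (iM _ _ _)).
rewrite (eq_bigr (fun j : 'I_k.+1 =>
  (2 * (j.+1%:R / (n.+1%:R * n.+2%:R) - p / n.+1%:R))%:E)); last first.
  move=> j _; rewrite /f; have := integralB _ (iM _ _ _) (iM _ _ _) => /= ->//.
  rewrite !IM -EFinB; congr (_%:E).
  have jn : (j <= n)%N by rewrite (leq_trans _ (ltnW kn)) // -ltnS.
  have bf := bin_fact jn.
  have {}bf : 'C(n, j)%:R * j`!%:R * (n - j)`!%:R = n`!%:R :> R.
    by rewrite -mulrA -!natrM bf.
  rewrite addSn subnKC // !factS !natrM.
  (* Since [n!] is the product of the binomial coefficient and two factorials, its being non-zero
     makes all three denominators non-zero for [field]. *)
  have n0 : n`!%:R != 0 :> R by rewrite pnatr_eq0 -lt0n fact_gt0.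
  rewrite -bf; rewrite -bf !mulf_eq0 !negb_or in n0.
  move: n0 => /andP[/andP[c0 j0] nj0].
  field; rewrite c0 j0 nj0 /= andbT; have nR := ler0n R n.
  by apply/andP; split; rewrite gt_eqF //; lra.
rewrite sumEFin; congr (_%:E).
have A0 : n.+1%:R != 0 :> R by rewrite pnatr_eq0.
have B0 : n.+2%:R != 0 :> R by rewrite pnatr_eq0.
move: (n.+1%:R) (n.+2%:R) A0 B0 => A B A0 B0.
elim: k {kn f} => [|k IHk]; first by rewrite big_ord1 /=; field; rewrite A0 B0.
rewrite big_ord_recr /= IHk -[k.+3%:R]natr1 -[k.+2%:R]natr1.
by field; rewrite A0 B0.
Qed.

(** With [m = n + 1] and [r = k + 1], the left side is squared bias plus variance of an order
    statistic of mean [r / m]. The hypotheses give [|r - p m| <= 1], so the first part is at most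
    [1 / m^2]; [r (m - r) <= m^2 / 4] bounds the second by [1 / (4 (m + 1))]. *)
Lemma order_stat_moment_bound (n k : nat) (p : R) : (8 <= n)%N -> (k < n)%N ->
    0 <= p <= 1 -> k%:R <= n%:R * p < k.+1%:R ->
  p ^+ 2 + (k.+1%:R * k.+2%:R / (n.+1%:R * n.+2%:R)
    - 2 * p * k.+1%:R / n.+1%:R) <= 3 / (8 * n%:R).
Proof.
move=> n8 kn /andP[p0 p1] /andP[h1 h2].
set m : R := n.+1%:R; set r : R := k.+1%:R.
have m0 : 0 < m by rewrite ltr0n.
have m2E : n.+2%:R = m + 1 by rewrite -natr1.
have r2E : k.+2%:R = r + 1 by rewrite -natr1.
have nE : n%:R = m - 1 by rewrite /m -natr1 addrK.
have kE : k%:R = r - 1 by rewrite /r -natr1 addrK.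
rewrite m2E r2E; rewrite nE kE in h1 h2 *; rewrite -/r in h2.
have m9 : 9 <= m by rewrite /m (ler_nat _ 9).
have -> : p ^+ 2 + (r * (r + 1) / (m * (m + 1)) - 2 * p * r / m) =
    (r - p * m) ^+ 2 / m ^+ 2 + r * (m - r) / (m ^+ 2 * (m + 1)).
  by field; apply/andP; split; lra.
have b1 : (r - p * m) ^+ 2 / m ^+ 2 <= 1 / m ^+ 2.
  by rewrite ler_pM2r ?invr_gt0 ?exprn_gt0 //; nra.
have b2 : r * (m - r) / (m ^+ 2 * (m + 1)) <= 1 / (4 * (m + 1)).
  rewrite ler_pdivrMr ?mulr_gt0 ?exprn_gt0 ?addr_gt0 //.
  rewrite (_ : 1 / _ * _ = m ^+ 2 / 4); last by field; lra.
  by have := sqr_ge0 (m - 2 * r); nra.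
apply: (le_trans (lerD b1 b2)).
rewrite -subr_ge0.
rewrite (_ : _ - _ =
  ((m + 1) * (3 * m ^+ 2 - 8 * (m - 1)) - 2 * m ^+ 2 * (m - 1))
  / (8 * (m - 1) * m ^+ 2 * (m + 1))); last first.
  by field; apply/and3P; split; lra.
(* The numerator expands to [m^3 - 3 m^2 + 8], which is positive for [m >= 9]. *)
apply: divr_ge0; first by nra.
by rewrite !mulr_ge0 ?sqr_ge0 //; lra.
Qed.

End BinomialTail.

(** * The distortion *)

Section Distortion.
Context (R : realType) (b : nat) (a : 'cV[R[i]]_(2 * b).+1) (g : R -> R).
Hypothesis ga : forall t : R, (g t)%:C = trigpoly a t.
Hypothesis g1 : forall t : R, `|g t| <= 1.
Context d (T : measurableType d) (P : probability T R).
Variable U : nat -> {RV P >-> R}.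
Hypothesis hU : iid_uniform01 U.

Lemma order_stat_mean_sq_dev n k (p : R) : (8 <= n)%N -> (k < n)%N ->
    0 <= p <= 1 -> k%:R <= n%:R * p < k.+1%:R ->
  (\int[P]_w ((order_stat (U^~ w) n k.+1 - p) ^+ 2)%:E <=
   (3 / (8 * n%:R))%:E)%E.
Proof.
move=> n8 kn p01 kp.
rewrite (second_moment_ccdf (Q := binomial_tail n k)) //; first last.
- by move=> x; exact: prob_order_stat_gt.
- exact: binomial_tail1.
- exact: binomial_tail0.
- exact: continuous_binomial_tail.
- exact: measurable_order_stat.
by rewrite integral_binomial_tail // -EFinD lee_fin order_stat_moment_bound.
Qed.

Lemma measurable_field : measurable_fun setT g.
Proof.
have -> : g = fun t => \sum_(k < (2 * b).+1)
    (complex.Re (a k 0) * cos (2 * pi * (freq k)%:~R * t)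
     - complex.Im (a k 0) * sin (2 * pi * (freq k)%:~R * t)).
  apply/funext => t; have /(congr1 (@complex.Re R)) := ga t.
  rewrite /= => ->; rewrite raddf_sum; apply: eq_bigr => k _.
  by case: (a k 0).
apply: measurable_sum => k.
by apply: continuous_measurable_fun; exact: continuous_cos_sin.
Qed.

(** Since [l < N], the requested rank is at most [n], so every sample is a genuine order
    statistic. *)
Lemma sample_rank_lt n (l : 'I_(2 * b).+1) : (0 < n)%N ->
  (Num.truncn (n%:R * l%:R * s_ R b) < n)%N.
Proof.
move=> n0; rewrite truncn_lt_nat ?s_E ?mulr_ge0 ?invr_ge0 ?ler0n //.
by rewrite ltr_pdivrMr ?ltr0n // ltr_pM2l ?ltr0n // ltr_nat ltn_ord.
Qed.

Lemma distortion_le n : (8 <= n)%N ->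
  (distortion b U g n <= (pi ^+ 2 * b%:R * (b%:R + 1) * (2 * b%:R + 1)
     / (2 * n%:R))%:E)%E.
Proof.
move=> n8; have n0 : (0 < n)%N by rewrite (leq_trans _ n8).
pose N := (2 * b).+1.
(* The squared Lipschitz constant of [g]. *)
pose C : R := 4 * pi ^+ 2 * (b%:R * (b%:R + 1) * (2 * b%:R + 1) / 3).
have C0 : 0 <= C.
  rewrite /C -sum_freq_sqr; apply: mulr_ge0; first by rewrite mulr_ge0 ?sqr_ge0.
  by apply: sumr_ge0 => k _; exact: sqr_ge0.
pose rk (l : 'I_N) := Num.truncn (n%:R * l%:R * s_ R b).
pose X (l : 'I_N) (w : T) := order_stat (U^~ w) n (rk l).+1.
have mX l : measurable_fun setT (X l).
  by apply: measurable_order_stat => //; exact: sample_rank_lt.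
have N0 : 0 < N%:R :> R by rewrite ltr0n.
rewrite /distortion unlock.
under eq_integral do rewrite (sq_errorE ga).
pose Y l w := N%:R^-1 * C * (X l w - l%:R * s_ R b) ^+ 2.
have mS l : measurable_fun setT (fun w => (X l w - l%:R * s_ R b) ^+ 2).
  by apply: measurable_funX; exact: measurable_funB.
have mY l : measurable_fun setT (EFin \o Y l).
  by apply/measurable_EFinP; exact: measurable_funM.
have NC0 : 0 <= N%:R^-1 * C by rewrite mulr_ge0 // invr_ge0.
have Y0 l w : 0 <= Y l w by apply: mulr_ge0 => //; exact: sqr_ge0.
(* The Lipschitz bound, applied for each outcome, replaces field differences by deviations of the
   order statistics from [l/N]. *)
apply: (@le_trans _ _ (\int[P]_w (\sum_(l < N) (Y l w)%:E))%E).
  apply: ge0_le_integral => //.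
  - move=> w _; rewrite lee_fin; apply: mulr_ge0; first by rewrite invr_ge0.
    by apply: sumr_ge0 => l _; exact: sqr_ge0.
  - apply/measurable_EFinP; apply: measurable_funM => //.
    apply: measurable_sum => l; apply: measurable_funX.
    apply: measurable_funB => //.
    by apply: measurableT_comp; [exact: measurable_field|exact: mX].
  - by apply: emeasurable_sum => l _; exact: mY.
  - move=> w _; rewrite sumEFin lee_fin mulr_sumr; apply: ler_sum => l _.
    rewrite /Y -[leRHS]mulrA ler_pM2l ?invr_gt0 //.
    exact: trigpoly_lipschitz.
rewrite (ge0_integral_sum _ measurableT mY) //; last first.
  by move=> l w _; rewrite lee_fin.
apply: (@le_trans _ _ (\sum_(l < N) (N%:R^-1 * C * (3 / (8 * n%:R)))%:E)%E).
  apply: lee_sum => l _.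
  rewrite (eq_integral (fun w => (N%:R^-1 * C)%:E *
    ((X l w - l%:R * s_ R b) ^+ 2)%:E)%E); last by move=> w _; rewrite -EFinM.
  rewrite ge0_integralZl //; first last.
  - by move=> w _; rewrite lee_fin sqr_ge0.
  - exact/measurable_EFinP/mS.
  rewrite [leRHS]EFinM lee_wpmul2l ?lee_fin //.
  apply: order_stat_mean_sq_dev => //; first exact: sample_rank_lt.
    rewrite s_E divr_ge0 //= ler_pdivrMr // mul1r ler_nat.
    by rewrite ltnW // ltn_ord.
  have h : 0 <= n%:R * l%:R * s_ R b by rewrite s_E !mulr_ge0 ?invr_ge0.
  by rewrite mulrA; exact: truncn_itv.
rewrite sumEFin sumr_const card_ord lee_fin -mulr_natr -/N.
(* The N equal terms cancel the factor [1/N], and the constants combine as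
   [4 * (1/3) * (3/8) = 1/2]. *)
rewrite le_eqVlt; apply/orP; left; apply/eqP; rewrite /C.
by field; rewrite pnatr_eq0 -lt0n n0 gt_eqF.
Qed.

End Distortion.

Theorem mainTheorem3 (R : realType) (b : nat) (hb : (1 <= b)%N)
  (a : 'cV[R[i]]_(2 * b).+1) (g : R -> R)
  (hga : forall t : R, (g t)%:C = trigpoly a t)
  (hg1 : forall t : R, `|g t| <= 1)
  (d : measure_display) (T : measurableType d) (P : probability T R)
  (U : nat -> {RV P >-> R}) (hU : iid_uniform01 U) :
  (exists r : nat -> R,
    r =O_\oo (fun n : nat => Num.sqrt (1 / n%:R) : R) /\
    \forall n \near \oo,
      (n%:R%:E * distortion b U g n <=
       (pi ^+ 2 * b%:R ^+ 2 * (2 * b%:R + 1) * (1 + r n))%:E)%E) /\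
  (fun n : nat => fine (distortion b U g n) : R) =O_\oo
    (fun n : nat => 1 / n%:R : R).
Proof.
have D0 n : (0 <= distortion b U g n)%E.
  by apply: expectation_ge0 => w; apply: Rintegral_ge0 => t _; exact: sqr_ge0.
set K : R := pi ^+ 2 * b%:R * (b%:R + 1) * (2 * b%:R + 1).
have D_le n : (8 <= n)%N -> (distortion b U g n <= (K / (2 * n%:R))%:E)%E.
  exact: (distortion_le hga hg1 hU).
split.
  (* The bound holds with no error term from [n = 8] on. *)
  exists (fun=> 0); split.
    apply/eqOP; near=> k; apply: nearW => n /=.
    rewrite normr0; apply: mulr_ge0 => //; near: k; exact: nbhs_pinfty_ge.
  exists 8%N => // n /= n8; rewrite addr0 mulr1.
  have n0 : 0 < n%:R :> R by rewrite ltr0n (leq_trans _ n8).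
  apply: (@le_trans _ _ (n%:R%:E * (K / (2 * n%:R))%:E)%E).
    by apply: lee_wpmul2l; [rewrite lee_fin ltW|exact: D_le].
  rewrite -EFinM lee_fin.
  rewrite (_ : n%:R * _ = K / 2); last by field; rewrite gt_eqF.
  have b1 : 1 <= b%:R :> R by rewrite (ler_nat _ 1).
  have p2 : 0 <= pi ^+ 2 * b%:R * (2 * b%:R + 1) :> R.
    apply: mulr_ge0; first by apply: mulr_ge0 => //; exact: sqr_ge0.
    by apply: addr_ge0 => //; exact: mulr_ge0.
  (* Here [b >= 1] enters, through [(b + 1) / 2 <= b]. *)
  rewrite /K; nra.
apply/eqOP; near=> k; near=> n.
have n8 : (8 <= n)%N by near: n; exists 8%N.
have n0 : 0 < n%:R :> R by rewrite ltr0n (leq_trans _ n8).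
have := D_le n n8; have := D0 n.
(* The two bounds exclude infinite values, so [fine] returns the distortion itself and not its
   default. *)
case: (distortion b U g n) => [x| |] //; rewrite !lee_fin /= => x0 xK.
have n1 : 0 <= 1 / n%:R :> R by rewrite div1r invr_ge0 ltW.
rewrite (ger0_norm x0) (ger0_norm n1).
(* What remains is [K / 2 <= k], true of every large enough [k]. *)
apply: (le_trans xK); rewrite invfM mulrA mul1r ler_pM2r ?invr_gt0 //.
Unshelve. all: by end_near. Qed.
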